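(* Consider the linear model $m_{t+1}=Am_t+\bar w_t$, $t\in\mathbb{N}$, with per-step cost $c(m_t,\hat m_t,a_t)=(m_t-\hat m_t)^\intercal(m_t-\hat m_t)z(a_t)+\ell(m_t,a_t)$, where $\hat m_t=h_t(o_{1:t},a_{1:t-1})$ is a generic (possibly nonlinear) estimator. The problem of finding the optimal estimator is separated from that of finding the optimal sampling strategy: for every sampling strategy $g$, an optimal estimator is $\hat m_t=A^{y_t}x_t$, which has the structure of the minimum mean-square estimator and satisfies the Kalman-like update $$\hat m_{t+1}=A\hat m_t+L(y_{t+1})(x_{t+1}-A\hat m_t),\qquad \hat m_1=m_1,$$ with $L(y)=1$ (identity) if $y=0$ and $L(y)=0$ if $y\ne0$. This holds regardless of the sampling strategy, the order (dimension) of the dynamics, the probability distributions of the initial state and of the additive noises, and the credibility probability $q$.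
   Context: $m_t\in\mathbb{R}^{d}$ (here $d=Dd_s$) is the data (a weighted average of node states), $A$ a real $d\times d$ matrix, and $\bar w_t$ an additive noise with zero mean and finite covariance, the $\bar w_t$ being mutually independent over time and independent of $m_1$ and of the credibility variables. Action $a_t\in\{0,1\}$ ($1$ = collect). Observations: $o_1=m_1$; if $a_t=0$ then $o_{t+1}=\mathtt{blank}$; if $a_t=1$ then $o_{t+1}=m_{t+1}$ with probability $q\in[0,1]$ (independently of everything else) and $\mathtt{blank}$ otherwise. A sampling strategy is $a_t=g_t(o_{1:t},a_{1:t-1})$. $x_t$ is the last non-blank (credible) observation up to time $t$ and $y_t\in\{0,1,2,\ldots\}$ the time elapsed since it was received ($x_1=m_1$, $y_1=0$). $z:\{0,1\}\to\mathbb{R}_{\ge0}$ and $\ell:\mathbb{R}^d\times\{0,1\}\to\mathbb{R}_{\ge0}$. Optimality of the estimator refers to minimizing the expected (discounted, finite- or infinite-horizon) sum of per-step costs over all estimators $h_t$. *)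

(* Defs.v *)
From HB Require Import structures.
From mathcomp Require Import all_boot all_order all_algebra.
From mathcomp Require Import all_classical all_reals all_analysis.
Set Implicit Arguments. Unset Strict Implicit. Unset Printing Implicit Defensive.
Import Order.TTheory GRing.Theory Num.Theory.
Local Open Scope classical_set_scope.
Local Open Scope ring_scope.

(* Conventions:  time is 0-based internally:
   state k  = m_{k+1},  w k = \bar w_{k+1},  action k = a_{k+1},
   cred k   = credibility variable of the observation o_{k+2} (which is
              produced after the action a_{k+1}),
   history k = (o_{1:k+1}, a_{1:k}),  actions: true = 1 = collect. *)

(* A history: the list of observations (None = blank) and the list of actions. *)
Definition hist (R : realType) (n : nat) := (seq (option 'cV[R]_n) * seq bool)%type.

Definition vec_gen (R : realType) (n : nat) : set (set 'cV[R]_n) :=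
  [set S | exists (i : 'I_n) (B : set R), measurable B /\ S = [set v : 'cV[R]_n | B (v i 0)]].

Definition vec_measurable_fun (R : realType) (n : nat) (f : 'cV[R]_n -> R) :=
  forall B : set R, measurable B -> <<s @vec_gen R n >> (f @^-1` B).

(* Natural sigma-algebra on histories: disjoint union over lengths of products
   of (Borel(R^n) + {blank}) and of {0,1}. *)
Definition hist_gen (R : realType) (n : nat) : set (set (hist R n)) :=
  [set S | (exists l : nat, S = [set h : hist R n | size h.1 = l])
        \/ (exists l : nat, S = [set h : hist R n | size h.2 = l])
        \/ (exists k : nat, S = [set h : hist R n | nth None h.1 k = None])
        \/ (exists (k : nat) (i : 'I_n) (B : set R), measurable B /\
              S = [set h : hist R n | exists v : 'cV[R]_n, nth None h.1 k = Some v /\ B (v i 0)])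
        \/ (exists k : nat, S = [set h : hist R n | nth false h.2 k])].

Definition hist_measurable_fun (R : realType) (n : nat) (f : hist R n -> R) :=
  forall B : set R, measurable B -> <<s @hist_gen R n >> (f @^-1` B).

Definition strategy (R : realType) (n : nat) := nat -> hist R n -> bool.
Definition estimator (R : realType) (n : nat) := nat -> hist R n -> 'cV[R]_n.

Definition admissible_strategy (R : realType) (n : nat) (g : strategy R n) :=
  forall k, <<s @hist_gen R n >> [set h | g k h].

Definition admissible_estimator (R : realType) (n : nat) (h : estimator R n) :=
  forall k (i : 'I_n), hist_measurable_fun (fun x => h k x i 0).

Fixpoint xy_rev (R : realType) (n : nat) (l : seq (option 'cV[R]_n)) : 'cV[R]_n * nat :=
  match l with
  | [::] => (0, 0%N)
  | Some v :: _ => (v, 0%N)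
  | None :: l' => ((xy_rev l').1, (xy_rev l').2.+1)
  end.

Definition last_obs (R : realType) (n : nat) (h : hist R n) : 'cV[R]_n := (xy_rev (rev h.1)).1.
Definition elapsed (R : realType) (n : nat) (h : hist R n) : nat := (xy_rev (rev h.1)).2.

Definition opt_estimator (R : realType) (n : nat) (A : 'M[R]_n) : estimator R n :=
  fun _ h => A ^+ elapsed h *m last_obs h.

Definition gainL (R : realType) (n : nat) (y : nat) : 'M[R]_n :=
  if y == 0%N then 1%:M else 0.

Fixpoint state (R : realType) (n : nat) (T : Type) (A : 'M[R]_n)
    (m1 : T -> 'cV[R]_n) (w : nat -> T -> 'cV[R]_n) (k : nat) (om : T) : 'cV[R]_n :=
  match k with
  | 0 => m1 om
  | k'.+1 => A *m state A m1 w k' om + w k' om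
  end.

Fixpoint history (R : realType) (n : nat) (T : Type) (A : 'M[R]_n)
    (m1 : T -> 'cV[R]_n) (w : nat -> T -> 'cV[R]_n) (cred : nat -> T -> bool)
    (g : strategy R n) (k : nat) (om : T) : hist R n :=
  match k with
  | 0 => ([:: Some (m1 om)], [::])
  | k'.+1 =>
      let hk := history A m1 w cred g k' om in
      let a := g k' hk in
      (rcons hk.1 (if a && cred k' om then Some (state A m1 w k'.+1 om) else None),
       rcons hk.2 a)
  end.

Definition action (R : realType) (n : nat) (T : Type) (A : 'M[R]_n)
    (m1 : T -> 'cV[R]_n) (w : nat -> T -> 'cV[R]_n) (cred : nat -> T -> bool)
    (g : strategy R n) (k : nat) (om : T) : bool :=
  g k (history A m1 w cred g k om).

Definition step_cost (R : realType) (n : nat) (z : bool -> R) (ell : 'cV[R]_n -> bool -> R)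
    (m mhat : 'cV[R]_n) (a : bool) : R :=
  ((m - mhat)^T *m (m - mhat)) 0 0 * z a + ell m a.

Definition stage_cost (R : realType) (n : nat) (T : Type) (A : 'M[R]_n)
    (m1 : T -> 'cV[R]_n) (w : nat -> T -> 'cV[R]_n) (cred : nat -> T -> bool)
    (z : bool -> R) (ell : 'cV[R]_n -> bool -> R)
    (g : strategy R n) (h : estimator R n) (k : nat) (om : T) : R :=
  step_cost z ell (state A m1 w k om)
    (h k (history A m1 w cred g k om)) (action A m1 w cred g k om).

Definition finite_cost (R : realType) (n : nat) (d0 : measure_display) (Om : measurableType d0)
    (P : probability Om R) (A : 'M[R]_n)
    (m1 : Om -> 'cV[R]_n) (w : nat -> Om -> 'cV[R]_n) (cred : nat -> Om -> bool)
    (z : bool -> R) (ell : 'cV[R]_n -> bool -> R)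
    (g : strategy R n) (h : estimator R n) (beta : R) (Tn : nat) : \bar R :=
  (\int[P]_om ((\sum_(k < Tn) beta ^+ k * stage_cost A m1 w cred z ell g h k om)%:E))%E.

Definition infinite_cost (R : realType) (n : nat) (d0 : measure_display) (Om : measurableType d0)
    (P : probability Om R) (A : 'M[R]_n)
    (m1 : Om -> 'cV[R]_n) (w : nat -> Om -> 'cV[R]_n) (cred : nat -> Om -> bool)
    (z : bool -> R) (ell : 'cV[R]_n -> bool -> R)
    (g : strategy R n) (h : estimator R n) (beta : R) : \bar R :=
  (\int[P]_om (\sum_(0 <= k <oo) (beta ^+ k * stage_cost A m1 w cred z ell g h k om)%:E))%E.

Definition vec_events (T : Type) (R : realType) (n : nat) (X : T -> 'cV[R]_n) : set (set T) :=
  <<s [set S | exists (i : 'I_n) (B : set R), measurable B /\ S = [set om | B (X om i 0)]] >>.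

Definition bool_events (T : Type) (b : T -> bool) : set (set T) :=
  [set S | exists Bb : set bool, S = b @^-1` Bb].

(* Sources of randomness: None = m_1, Some (inl t) = noise w t, Some (inr t) = cred t. *)
Definition source := option (nat + nat).

Definition source_events (T : Type) (R : realType) (n : nat)
    (m1 : T -> 'cV[R]_n) (w : nat -> T -> 'cV[R]_n) (cred : nat -> T -> bool)
    (s : source) : set (set T) :=
  match s with
  | None => vec_events m1
  | Some (inl t) => vec_events (w t)
  | Some (inr t) => bool_events (cred t)
  end.

Definition mutually_independent (R : realType) (n : nat) (d0 : measure_display)
    (Om : measurableType d0) (P : probability Om R)
    (m1 : Om -> 'cV[R]_n) (w : nat -> Om -> 'cV[R]_n) (cred : nat -> Om -> bool) :=
  forall (I : seq source), uniq I ->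
  forall E : source -> set Om,
    (forall s, s \in I -> source_events m1 w cred s (E s)) ->
    P (\bigcap_(s in [set` I]) E s) = (\prod_(s <- I) P (E s))%E.

(* Main.v *)
(* Fix k and split according to the elapsed time j, so that s = k - j is the time
   of the last credible observation. Let w' be the noise switched off from time s
   on. Blanks carry no value, so on {y_k = j} the history coincides with the one
   driven by w', which depends only on m_1, the noise before s and the credibility
   variables, and the error of A^y x is the accumulated noise since s, which is
   centred and independent of all that. Hence any other estimator adds to this
   error an independent shift, which can only increase its second moment. *)
Require Import Defs.
From HB Require Import structures.
From mathcomp Require Import all_boot all_order all_algebra.
From mathcomp Require Import all_classical all_reals all_analysis.
From mathcomp Require Import measurable_realfun ring.
Set Implicit Arguments.
Unset Strict Implicit.
Import Order.TTheory GRing.Theory Num.Theory.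
Local Open Scope classical_set_scope.
Local Open Scope ring_scope.

(** The obstacle is integrability. A competing estimator is only measurable and [m1] has no assumed
    moments, so neither the conditional mean of the state given the history nor an orthogonality
    argument in the square-integrable functions is at hand. All comparisons are therefore between
    integrals of nonnegative functions with values in [0, +oo], by Tonelli, and only the accumulated
    noise is ever integrated with a sign. A second point is the weight [z], which depends on the
    action and hence on the history. On the event of a fixed elapsed time it is a function of the
    past, so it joins the indicator of that event in a nonnegative factor [C] that is frozen
    together with the shift. *)

(** * Independence of sigma-algebras and second moments under a shift *)

Lemma mul_prob_lambda_system (d : measure_display) (T : measurableType d)
    (R : realType) (P : probability T R) (B : set T) : measurable B ->
  lambda_system setT
    [set A | measurable A /\ (P (A `&` B) = P A * P B)%E].
Proof.
move=> mB; apply/dynkin_lambda_system; split => /=.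
- by split; [exact: measurableT|rewrite setTI probability_setT mul1e].
- move=> A [mA AB]; split; first exact: measurableC.
  rewrite setIC -setDE measureD//; last by rewrite ltey_eq fin_num_measure.
  transitivity (P B - P A * P B)%E; first by congr (_ - _)%E; rewrite setIC.
  rewrite probability_setC//.
  by rewrite muleBl ?mul1e// fin_num_measure.
- move=> F tF mF; split; first by apply: bigcup_measurable => k _; case: (mF k).
  rewrite setI_bigcupl.
  have mFk k : measurable (F k) by case: (mF k).
  have tFB : trivIset setT (fun k => F k `&` B) by exact: trivIset_setIr.
  have mFB k : measurable (F k `&` B) by exact: measurableI.
  have -> : P (\bigcup_k (F k `&` B)) = (\sum_(0 <= k <oo) P (F k `&` B))%E.
    by apply/esym/cvg_lim => //; apply: measure_sigma_additive.
  have -> : P (\bigcup_k F k) = (\sum_(0 <= k <oo) P (F k))%E.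
    by apply/esym/cvg_lim => //; apply: measure_sigma_additive.
  rewrite muleC -(fineK (fin_num_measure P B mB)) -nneseriesZl//.
  by apply: eq_eseriesr => k _; rewrite fineK ?fin_num_measure// muleC; case: (mF k).
Qed.

(** Dynkin's argument run twice: the generators of one side are replaced by the generated
    sigma-algebra while the other side is held fixed, then the roles are exchanged. *)
Lemma independent_g_sigma_algebra (d : measure_display) (T : measurableType d)
    (R : realType) (P : probability T R) (G H : set (set T)) :
  setI_closed G -> setI_closed H ->
  G `<=` measurable -> H `<=` measurable ->
  (forall A B, G A -> H B -> (P (A `&` B) = P A * P B)%E) ->
  forall A B, <<s G >> A -> <<s H >> B -> (P (A `&` B) = P A * P B)%E.
Proof.
move=> IG IH mG mH GH.
have step1 A B : <<s G >> A -> H B -> (P (A `&` B) = P A * P B)%E.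
  move=> sA HB.
  suff [] : [set A | measurable A /\ (P (A `&` B) = P A * P B)%E] A by [].
  move: A sA; apply: lambda_system_subset => //.
    exact/mul_prob_lambda_system/mH.
  by move=> A GA; split; [exact: mG|exact: GH].
move=> A B sA sB.
have mA : measurable A.
  by move: A sA; apply: smallest_sub => //; exact: sigma_algebra_measurable.
suff [] : [set B | measurable B /\ (P (B `&` A) = P B * P A)%E] B.
  by rewrite setIC muleC.
move: B sB; apply: lambda_system_subset => //.
  exact: mul_prob_lambda_system.
by move=> B HB; split; [exact: mH|rewrite setIC muleC; exact: step1].
Qed.

(** An infinite right side is trivial. Otherwise X^2 is the integrable (X + a)^2 minus the
    integrable 2aX + a^2, and centring leaves E X^2 = E (X + a)^2 - a^2. *)
Lemma le_integral_sqr_shift (d : measure_display) (T : measurableType d)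
    (R : realType) (P : probability T R) (X : T -> R) (a : R) :
  P.-integrable setT (EFin \o X) -> (\int[P]_x (X x)%:E = 0)%E ->
  (\int[P]_x ((X x) ^+ 2)%:E <= \int[P]_x ((X x + a) ^+ 2)%:E)%E.
Proof.
move=> iX X0.
have mX : measurable_fun setT X by apply/measurable_EFinP; case/integrableP: iX.
have mXa : measurable_fun setT (fun x => (X x + a) ^+ 2).
  by apply: measurable_funX; exact: measurable_funD.
have [->|fin] := eqVneq (\int[P]_x ((X x + a) ^+ 2)%:E)%E +oo%E; first exact: leey.
have iXa : P.-integrable setT (fun x => ((X x + a) ^+ 2)%:E).
  apply/integrableP; split; first exact/measurable_EFinP.
  under eq_integral do rewrite gee0_abs ?lee_fin ?sqr_ge0//.
  by rewrite ltey.
have iaX : P.-integrable setT (fun x => ((a *+ 2)%:E * (X x)%:E)%E).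
  exact: integrableZl.
have ia : P.-integrable setT (cst (a ^+ 2)%:E) by exact: finite_measure_integrable_cst.
rewrite [leLHS](_ : _ = \int[P]_x (((X x + a) ^+ 2)%:E -
    ((a *+ 2)%:E * (X x)%:E + (a ^+ 2)%:E)))%E; last first.
  apply: eq_integral => x _; rewrite -EFinM -EFinD; congr EFin.
  by ring.
rewrite integralB//; last exact: integrableD.
rewrite integralD// integralZl// X0 mule0 add0e integral_cst//.
by rewrite geeDl// oppe_le0 mule_ge0// lee_fin sqr_ge0.
Qed.

(** The inner integral is Tonelli's partial integral against the law of [X], composed with [Y].
    Comparing two iterated integrals requires this measurability. *)
Lemma measurable_integral_pair (d d1 d2 : measure_display) (T : measurableType d)
    (T1 : measurableType d1) (T2 : measurableType d2) (R : realType)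
    (P : probability T R) (Y : T -> T1) (X : T -> T2) (f : T1 * T2 -> \bar R) :
  measurable_fun setT Y -> measurable_fun setT X ->
  measurable_fun setT f -> (forall x, 0 <= f x)%E ->
  measurable_fun setT (fun s => \int[P]_t f (Y s, X t))%E.
Proof.
move=> mY mX mf f0.
pose X' : {mfun T >-> T2} := HB.pack X (isMeasurableFun.Build _ _ _ _ X mX).
have mF := @measurable_fun_fubini_tonelli_F _ _ T1 T2 R
  (distribution P X') f mf f0.
apply: (eq_measurable_fun (fubini_F (distribution P X') f \o Y)); last first.
  exact: measurableT_comp.
move=> s _; rewrite /= /fubini_F ge0_integral_distribution//.
by apply: measurableT_comp => //; exact: measurable_pair1.
Qed.

(** Independence says that the joint law agrees with the product of the marginal laws on rectangles,
    hence everywhere; Tonelli does the rest. *)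
Lemma integral_independent (d d1 d2 : measure_display) (T : measurableType d)
    (T1 : measurableType d1) (T2 : measurableType d2) (R : realType)
    (P : probability T R) (Y : T -> T1) (X : T -> T2) (f : T1 * T2 -> \bar R) :
  measurable_fun setT Y -> measurable_fun setT X ->
  (forall A B, measurable A -> measurable B ->
    P (Y @^-1` A `&` X @^-1` B) = P (Y @^-1` A) * P (X @^-1` B))%E ->
  measurable_fun setT f -> (forall x, 0 <= f x)%E ->
  (\int[P]_t f (Y t, X t) = \int[P]_s \int[P]_t f (Y s, X t))%E.
Proof.
move=> mY mX ind mf f0.
have mYX : measurable_fun setT (fun t => (Y t, X t)) by exact: measurable_fun_pair.
pose Y' : {mfun T >-> T1} := HB.pack Y (isMeasurableFun.Build _ _ _ _ Y mY).
pose X' : {mfun T >-> T2} := HB.pack X (isMeasurableFun.Build _ _ _ _ X mX).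
pose YX' : {mfun T >-> (T1 * T2)%type} :=
  HB.pack (fun t => (Y t, X t)) (isMeasurableFun.Build _ _ _ _ _ mYX).
have mfy y : measurable_fun setT (fun x => f (y, x)).
  by apply: measurableT_comp => //; exact: measurable_pair1.
transitivity (\int[distribution P YX']_z f z)%E.
  by rewrite ge0_integral_distribution.
transitivity (\int[distribution P Y' \x distribution P X']_z f z)%E.
  apply: eq_measure_integral => A mA _; apply/esym.
  apply: product_measure_unique => // B C mB mC; exact: ind.
rewrite fubini_tonelli1//.
have mF := @measurable_fun_fubini_tonelli_F _ _ T1 T2 R
  (distribution P X') f mf f0.
rewrite ge0_integral_distribution//; last by move=> y; exact: integral_ge0.
apply: eq_integral => s _ /=.
by rewrite /fubini_F ge0_integral_distribution.
Qed.

(* Fubini on the joint law: given [Y] the estimate is a constant shift of the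
   centred variable [X], so no integrability of [D] is needed. *)
Lemma le_integral_independent_shift (d d1 : measure_display)
    (T : measurableType d) (T1 : measurableType d1) (R : realType)
    (P : probability T R) (Y : T -> T1) (C D : T1 -> R) (X : T -> R) :
  measurable_fun setT Y -> measurable_fun setT C -> measurable_fun setT D ->
  (forall y, 0 <= C y) ->
  P.-integrable setT (EFin \o X) -> (\int[P]_x (X x)%:E = 0)%E ->
  (forall A B, measurable A -> measurable B ->
    P (Y @^-1` A `&` X @^-1` B) = P (Y @^-1` A) * P (X @^-1` B))%E ->
  (\int[P]_t (C (Y t) * X t ^+ 2)%:E <=
   \int[P]_t (C (Y t) * (X t + D (Y t)) ^+ 2)%:E)%E.
Proof.
move=> mY mC mD C0 iX X0 ind.
have mX : measurable_fun setT X by apply/measurable_EFinP; case/integrableP: iX.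
(* The switch [b] puts both integrands in one family: [b = 0] gives the left side and [b = 1] the
   right side. *)
pose f (b : R) (z : T1 * R) := (C z.1 * (z.2 + b * D z.1) ^+ 2)%:E.
have mf b : measurable_fun setT (f b).
  apply/measurable_EFinP; apply: measurable_funM; first exact: measurableT_comp.
  apply: measurable_funX; apply: measurable_funD => //.
  by apply: measurable_funM => //; apply: measurableT_comp.
have f0 b z : (0 <= f b z)%E by rewrite lee_fin mulr_ge0// sqr_ge0.
have mXb b s : measurable_fun setT (fun t => ((X t + b * D (Y s)) ^+ 2)%:E).
  by apply/measurable_EFinP; apply: measurable_funX; exact: measurable_funD.
rewrite (_ : \int[P]_t (C (Y t) * X t ^+ 2)%:E =
  \int[P]_t f 0%R (Y t, X t))%E; last first.
  by apply: eq_integral => t _; rewrite /f mul0r addr0.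
rewrite [leRHS](_ : _ = \int[P]_t f 1%R (Y t, X t))%E; last first.
  by apply: eq_integral => t _; rewrite /f mul1r.
rewrite !integral_independent//; apply: ge0_le_integral => //.
- by move=> s _; apply: integral_ge0.
- exact: measurable_integral_pair.
- exact: measurable_integral_pair.
move=> s _; rewrite /f/=.
under eq_integral do rewrite EFinM.
under [leRHS]eq_integral do rewrite EFinM.
rewrite !ge0_integralZl//; try by [rewrite lee_fin|move=> t _; rewrite lee_fin sqr_ge0].
apply: lee_wpmul2l; first by rewrite lee_fin.
under eq_integral do rewrite mul0r addr0.
exact: le_integral_sqr_shift.
Qed.

(** * Histories as a measurable space, and measurability of the estimate *)

HB.instance Definition _ (R : realType) (n : nat) :=
  Choice.copy (hist R n) (seq (option 'cV[R]_n) * seq bool)%type.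
HB.instance Definition _ (R : realType) (n : nat) :=
  isPointed.Build (hist R n) ([::], [::]).

Definition hist_space (R : realType) (n : nat) :=
  g_sigma_algebraType (@hist_gen R n).

(** The estimate reads the observations alone, so the two action lists can be unrelated; this lets
    [b] be the shorter list of the preceding history. *)
Lemma opt_estimator_rcons {R : realType} {n : nat} {A : 'M[R]_n} {k}
    {s : seq (option 'cV[R]_n)} {a : seq bool} (b : seq bool) {o : option 'cV[R]_n} :
  opt_estimator A k (rcons s o, a) =
    if o is Some v then v else A *m opt_estimator A k (s, b).
Proof.
rewrite /opt_estimator /elapsed /last_obs /= rev_rcons /=.
by case: o => [v|] /=; rewrite ?expr0 ?mul1mx// exprS -mulmxA.
Qed.

Lemma elapsed_rcons {R : realType} {n : nat}
    {s : seq (option 'cV[R]_n)} {a : seq bool} (b : seq bool) {o : option 'cV[R]_n} :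
  elapsed (rcons s o, a) = if o then 0%N else (elapsed (s, b)).+1.
Proof. by rewrite /elapsed /= rev_rcons; case: o. Qed.

Lemma last_obs_rcons {R : realType} {n : nat}
    {s : seq (option 'cV[R]_n)} {a : seq bool} (b : seq bool) {o : option 'cV[R]_n} :
  last_obs (rcons s o, a) = if o is Some v then v else last_obs (s, b).
Proof. by rewrite /last_obs /= rev_rcons; case: o. Qed.

Section hist_measurability.
Variables (R : realType) (n : nat).
Local Notation HT := (hist_space R n).

Lemma hist_measurable_funP (f : hist R n -> R) :
  measurable_fun setT (f : HT -> R) <-> hist_measurable_fun f.
Proof.
split=> [mf B mB|mf _ B mB]; first by rewrite -[_ @^-1` _]setTI; exact: mf.
by rewrite setTI; exact: mf.
Qed.

Lemma measurable_size_obs l : measurable ([set h | size h.1 = l] : set HT).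
Proof. by apply: sub_sigma_algebra; left; exists l. Qed.

Lemma measurable_blank k : measurable ([set h | nth None h.1 k = None] : set HT).
Proof. by apply: sub_sigma_algebra; right; right; left; exists k. Qed.

Lemma measurable_fun_blank k :
  measurable_fun setT (fun h : HT => ~~ isSome (nth None h.1 k)).
Proof.
apply: (measurable_fun_bool true); rewrite setTI.
by rewrite (_ : _ @^-1` _ = [set h | nth None h.1 k = None]);
  [exact: measurable_blank|apply/seteqP; split=> h /=; case: nth].
Qed.

Lemma measurable_obs k (i : 'I_n) :
  measurable_fun setT (fun h : HT => (odflt 0 (nth None h.1 k)) i 0).
Proof.
move=> _ B mB; rewrite setTI.
(* A blank is read as the default vector 0, so blank histories belong to the preimage exactly when
   [B] contains 0. *)
rewrite (_ : _ @^-1` B =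
    [set h : HT | exists v, nth None h.1 k = Some v /\ B (v i 0)] `|`
    ([set h : HT | nth None h.1 k = None] `&` [set h | B 0])).
  apply: measurableU.
    by apply: sub_sigma_algebra; do 3 right; left; exists k, i, B.
  apply: measurableI; first exact: measurable_blank.
  have [B0|B0] := pselect (B 0).
    by rewrite (_ : [set _ | _] = setT)//; apply/seteqP; split.
  by rewrite (_ : [set _ | _] = set0)//; apply/seteqP; split.
apply/seteqP; split=> h /=.
- case: (nth None h.1 k) => [v|] /=; first by left; exists v.
  by rewrite mxE; right.
- by case=> [[v [-> ]]//|[-> B0]/=]; rewrite mxE.
Qed.

Lemma measurable_fun_vec d (T : measurableType d) (A : 'M[R]_n) (v : T -> 'cV[R]_n) :
  (forall i, measurable_fun setT (fun t => v t i 0)) ->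
  forall i, measurable_fun setT (fun t => (A *m v t) i 0).
Proof.
move=> mv i; under eq_fun do rewrite mxE.
by apply: measurable_sum => j; exact: measurable_funM.
Qed.

(** Truncation replaces the recursion over lists of unbounded length by an induction on [l]. The
    full history is recovered on the event that it has exactly [l] observations, and these events
    form a countable partition. *)
Let prefix l (h : hist R n) : hist R n := (take l h.1, h.2).

Let prefixS l h : prefix l.+1 h =
  if (l < size h.1)%N then (rcons (take l h.1) (nth None h.1 l), h.2)
  else prefix l h.
Proof.
rewrite /prefix; case: ltnP => ls; first by rewrite (take_nth None).
by rewrite !take_oversize// leqW.
Qed.

Let measurable_fun_obs_size l : measurable_fun setT (fun h : HT => (l < size h.1)%N).
Proof.
apply: (measurable_fun_bool true); rewrite setTI.
rewrite (_ : _ @^-1` _ = \bigcup_(m in [set m | (l < m)%N]) [set h : HT | size h.1 = m]).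
  by apply: bigcup_measurable => m _; exact: measurable_size_obs.
apply/seteqP; split=> h /=; first by exists (size h.1).
by case=> m /= lm ->.
Qed.

Lemma opt_estimator_admissible (A : 'M[R]_n) : admissible_estimator (opt_estimator A).
Proof.
have mp l : forall i : 'I_n,
    measurable_fun setT (fun h : HT => opt_estimator A 0 (prefix l h) i 0).
  elim: l => [|l ih] i.
    apply: (eq_measurable_fun (cst ((A ^+ 0 *m 0 : 'cV[R]_n) i 0))) => //.
    by move=> h _; rewrite /opt_estimator /elapsed /last_obs /= take0.
  apply: (eq_measurable_fun (fun h : HT =>
    if (l < size h.1)%N then
      if ~~ isSome (nth None h.1 l) then (A *m opt_estimator A 0 (prefix l h)) i 0
      else (odflt 0 (nth None h.1 l)) i 0
    else opt_estimator A 0 (prefix l h) i 0)).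
    move=> h _; rewrite prefixS; case: ifP => // _.
    by rewrite (opt_estimator_rcons h.2); case: (nth _ _ _).
  apply: measurable_fun_ifT => //; apply: measurable_fun_ifT.
  - exact: measurable_fun_blank.
  - exact: measurable_fun_vec.
  - exact: measurable_obs.
move=> k i; apply/hist_measurable_funP => _ B mB; rewrite setTI.
rewrite (_ : _ @^-1` _ = \bigcup_l ([set h : HT | size h.1 = l] `&`
   (fun h : HT => opt_estimator A 0 (prefix l h) i 0) @^-1` B)).
  apply: bigcup_measurable => l _; apply: measurableI; first exact: measurable_size_obs.
  by rewrite -[_ @^-1` _]setTI; exact: mp.
apply/seteqP; split=> h /=.
- by move=> Bh; exists (size h.1) => //; split=> //=; rewrite /prefix take_size -surjective_pairing.
- by case=> l _ [/= <-]; rewrite /prefix take_size -surjective_pairing.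
Qed.

Lemma measurable_elapsed j : measurable ([set h | elapsed h = j] : set HT).
Proof.
have mp l : forall j,
    measurable_fun setT (fun h : HT => elapsed (prefix l h) == j).
  elim: l => [|l ih] {}j.
    apply: (eq_measurable_fun (cst (0%N == j))) => //.
    by move=> h _; rewrite /elapsed /= take0.
  apply: (eq_measurable_fun (fun h : HT =>
    if (l < size h.1)%N then
      (* The guard [0 < j] excludes [j = 0], whose predecessor is again 0, although a blank makes
         the elapsed time positive. *)
      if ~~ isSome (nth None h.1 l) then (0 < j)%N && (elapsed (prefix l h) == j.-1)
      else 0%N == j
    else elapsed (prefix l h) == j)).
    move=> h _; rewrite prefixS; case: ifP => // _.
    rewrite (elapsed_rcons h.2); case: (nth _ _ _) => //=.
    by case: j => //= j; rewrite eqSS.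
  apply: measurable_fun_ifT => //; apply: measurable_fun_ifT => //.
  - exact: measurable_fun_blank.
  - by apply: measurable_and => //; exact: measurable_cst.
rewrite (_ : [set _ | _] = \bigcup_l ([set h : HT | size h.1 = l] `&`
   (fun h : HT => elapsed (prefix l h) == j) @^-1` [set true])).
  apply: bigcup_measurable => l _; apply: measurableI; first exact: measurable_size_obs.
  by rewrite -[_ @^-1` _]setTI; exact: mp.
apply/seteqP; split=> h /=.
- move=> /eqP Bh; exists (size h.1) => //; split=> //=; rewrite /prefix take_size.
  by rewrite -surjective_pairing.
- by case=> l _ [/= <-]; rewrite /prefix take_size -surjective_pairing => /eqP.
Qed.

End hist_measurability.

(** * Pathwise dynamics and the splitting of the noise at a time [s] *)

Section dynamics.
Variables (R : realType) (n : nat) (T : Type) (A : 'M[R]_n).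
Variables (m1 : T -> 'cV[R]_n) (w : nat -> T -> 'cV[R]_n) (cred : nat -> T -> bool).
Variable g : strategy R n.

Definition noise_before (s t : nat) (om : T) : 'cV[R]_n :=
  if (t < s)%N then w t om else 0.

Definition noise_from (s t : nat) (om : T) : 'cV[R]_n :=
  if (t < s)%N then 0 else w t om.

Lemma size_history_obs k om : size (history A m1 w cred g k om).1 = k.+1.
Proof. by elim: k => //= k ih; rewrite size_rcons ih. Qed.

Lemma size_history_act k om : size (history A m1 w cred g k om).2 = k.
Proof. by elim: k => //= k ih; rewrite size_rcons ih. Qed.

(** The initial observation is never blank. *)
Lemma elapsed_history k om : (elapsed (history A m1 w cred g k om) <= k)%N.
Proof.
elim: k => //= k ih.
by rewrite (elapsed_rcons (history A m1 w cred g k om).2); case: ifP.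
Qed.

(** A blank raises the time and the elapsed time together, so their difference does not move; a
    credible observation resets the elapsed time to 0. *)
Lemma last_obs_history k om :
  last_obs (history A m1 w cred g k om) =
  state A m1 w (k - elapsed (history A m1 w cred g k om)) om.
Proof.
elim: k => [//|k ih].
rewrite [history _ _ _ _ _ k.+1 _]/= (elapsed_rcons (history A m1 w cred g k om).2).
rewrite (last_obs_rcons (history A m1 w cred g k om).2).
by case: ifP.
Qed.

Lemma opt_estimator_kalman k om :
  let mh := opt_estimator A k (history A m1 w cred g k om) in
  let hk1 := history A m1 w cred g k.+1 om in
  opt_estimator A k.+1 hk1
    = A *m mh + gainL R n (elapsed hk1) *m (last_obs hk1 - A *m mh).
Proof.
move=> mh hk1; rewrite /hk1 /mh /=; case: (history A m1 w cred g k om) => s b /=.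
rewrite (opt_estimator_rcons b) (elapsed_rcons b).
rewrite (last_obs_rcons b) /gainL.
by case: ifP => _ /=; rewrite ?mul1mx ?mul0mx ?addr0 ?subrKC.
Qed.

(** Superposition: the initial state goes with the first summand, so the second one is made of the
    noise from [s] on alone. *)
Lemma state_split s k om :
  state A m1 w k om =
  state A m1 (noise_before s) k om + state A (fun=> 0) (noise_from s) k om.
Proof.
elim: k => [|k ih] /=; first by rewrite addr0.
rewrite ih mulmxDr /noise_before /noise_from.
by case: ifP => _; rewrite addr0; [exact: addrAC|rewrite addrA].
Qed.

Lemma state_noise_before s i om :
  state A m1 (noise_before s) (s + i) om = A ^+ i *m state A m1 (noise_before s) s om.
Proof.
elim: i => [|i ih]; first by rewrite addn0 expr0 mul1mx.
by rewrite addnS /= ih /noise_before ltnNge leq_addr /= addr0 exprS mulmxA.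
Qed.

Lemma state_noise_before_eq s k om : (k <= s)%N ->
  state A m1 (noise_before s) k om = state A m1 w k om.
Proof. by elim: k => //= k ih ks; rewrite ih 1?ltnW// /noise_before ks. Qed.

End dynamics.

(** * Histories along a run of blanks *)

Section blanks.
Variables (R : realType) (n : nat) (T : Type) (A : 'M[R]_n).
Variables (m1 : T -> 'cV[R]_n) (w : nat -> T -> 'cV[R]_n) (cred : nat -> T -> bool).
Variables (g : strategy R n) (s : nat).
Local Notation H := (history A m1 w cred g).
Local Notation Hp := (history A m1 (noise_before w s) cred g).

Lemma history_noise_before_eq k om : (k <= s)%N -> Hp k om = H k om.
Proof.
elim: k => //= k ih ks; rewrite ih 1?ltnW//.
by rewrite state_noise_before_eq 1?ltnW// /noise_before ks.
Qed.

(* The two histories can only differ in the values observed after time [s], and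
   neither contains any as long as only blanks were received since then. *)
Lemma history_blanks i om :
  (i <= elapsed (H (s + i) om))%N || (i <= elapsed (Hp (s + i) om))%N ->
  Hp (s + i) om = H (s + i) om.
Proof.
elim: i => [|i ih]; first by rewrite addn0 history_noise_before_eq.
rewrite addnS /= (elapsed_rcons (H (s + i) om).2) (elapsed_rcons (Hp (s + i) om).2).
rewrite -!surjective_pairing.
(* If exactly one history received a value at this step, the other received a blank and so provides
   the bound for [i]. By induction the histories agreed so far, hence so did the actions and what
   was received: a contradiction. *)
case aH: (g (s + i) (H (s + i) om) && cred (s + i) om);
  case aHp: (g (s + i) (Hp (s + i) om) && cred (s + i) om) => //= e.
- by move: aHp; rewrite ih ?aH// -[(i <= elapsed (Hp _ _))%N]ltnS e orbT.
- by move: aHp; rewrite ih ?aH// -ltnS; rewrite orbF in e; rewrite e.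
- by rewrite ih.
Qed.

(** Either history may supply the bound in [history_blanks], which gives both implications. The
    event of elapsed time [i] is thus decided by the past noise and the credibility variables. *)
Lemma elapsed_blanks i om :
  (elapsed (H (s + i) om) == i) = (elapsed (Hp (s + i) om) == i).
Proof.
by apply/eqP/eqP => e; move: (e); rewrite history_blanks ?e ?leqnn ?orbT.
Qed.

(** With the noise switched off, the state moves by powers of [A] after time [s], so extrapolating
    the last observation is exact. This is why the shift vanishes for [opt_estimator]. *)
Lemma opt_estimator_blanks i om : elapsed (Hp (s + i) om) = i ->
  opt_estimator A (s + i) (Hp (s + i) om) =
  state A m1 (noise_before w s) (s + i) om.
Proof.
move=> e; rewrite state_noise_before /opt_estimator last_obs_history.
by rewrite e addnK.
Qed.

End blanks.

(** * Measurability of states, actions and histories *)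

Section process_measurability.
Variables (R : realType) (n : nat) (d : measure_display) (T : measurableType d).
Variables (A : 'M[R]_n) (m1 : T -> 'cV[R]_n) (w : nat -> T -> 'cV[R]_n).
Variables (cred : nat -> T -> bool) (g : strategy R n).
Hypothesis mm1 : forall i : 'I_n, measurable_fun setT (fun om => m1 om i 0).
Hypothesis mw : forall t (i : 'I_n), measurable_fun setT (fun om => w t om i 0).

Lemma measurable_state k (i : 'I_n) :
  measurable_fun setT (fun om => state A m1 w k om i 0).
Proof.
elim: k i => [|k ih] i //=; under eq_fun do rewrite mxE.
by apply: measurable_funD => //; exact: measurable_fun_vec.
Qed.

Hypothesis mcred : forall t, measurable [set om | cred t om].
Hypothesis mg : admissible_strategy g.
Local Notation H := (history A m1 w cred g).

Lemma measurable_fun_action k :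
  measurable_fun setT (H k : T -> hist_space R n) ->
  measurable_fun setT (fun om => g k (H k om)).
Proof.
move=> mH; apply: (measurable_fun_bool true); rewrite setTI.
by rewrite -[_ @^-1` _]setTI; apply: (mH measurableT [set h | g k h]); exact: mg.
Qed.

Let measurable_const (B : Prop) : measurable ([set _ | B] : set T).
Proof.
have [b|b] := pselect B.
- by rewrite (_ : [set _ | _] = setT)//; apply/seteqP; split.
- by rewrite (_ : [set _ | _] = set0)//; apply/seteqP; split.
Qed.

(** It suffices to check the generators. The space [T] is arbitrary because the lemma serves twice:
    on [Om], and on [Om] with the coarser sigma-algebra of the past and the truncated noise. *)
Lemma measurable_history k : measurable_fun setT (H k : T -> hist_space R n).
Proof.
elim: k => [|k ih].
  apply: measurability => // _ [S gS <-]; rewrite setTI.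
  case: gS => [[l ->]|[[l ->]|[[l ->]|[[l [i [B [mB ->]]]]|[l ->]]]]] /=.
  - exact: (measurable_const (1%N = l)).
  - exact: (measurable_const (0%N = l)).
  - case: l => [|l] /=; last exact: (measurable_const (nth None [::] l = None)).
    by rewrite (_ : _ @^-1` _ = set0)//; apply/seteqP; split.
  - case: l => [|l].
      rewrite (_ : _ @^-1` _ = (fun om => m1 om i 0) @^-1` B).
        by rewrite -[_ @^-1` _]setTI; exact: mm1.
      by apply/seteqP; split=> om /=; [case=> v [[->]]|exists (m1 om)].
    rewrite (_ : _ @^-1` _ = set0)//; apply/seteqP; split=> om //= [v].
    by rewrite nth_nil; case.
  - exact: (measurable_const (nth false [::] l)).
have pre S : <<s @hist_gen R n >> S -> measurable (H k @^-1` S).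
  by move=> mS; rewrite -[_ @^-1` _]setTI; exact: ih.
have ma : measurable_fun setT (fun om => g k (H k om) && cred k om).
  apply: measurable_and; first exact: measurable_fun_action.
  by apply: (measurable_fun_bool true); rewrite setTI; exact: mcred.
have {}ma b : measurable [set om | (g k (H k om) && cred k om) = b].
  by rewrite -[X in measurable X]setTI; exact: (ma measurableT [set b]).
apply: measurability => // _ [S gS <-]; rewrite setTI.
case: gS => [[l ->]|[[l ->]|[[l ->]|[[l [i [B [mB ->]]]]|[l ->]]]]] /=.
- rewrite (_ : _ @^-1` _ = [set om | k.+2 = l]); first exact: measurable_const.
  by apply/seteqP; split=> om /=; rewrite size_rcons size_history_obs.
- rewrite (_ : _ @^-1` _ = [set om | k.+1 = l]); first exact: measurable_const.
  by apply/seteqP; split=> om /=; rewrite size_rcons size_history_act.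
(* [H k] has [k.+1] observations, so the new one sits at position [k.+1]; past the end, [nth]
   returns a blank. *)
- have [lk|kl|->] := ltngtP l k.+1.
  + rewrite (_ : _ @^-1` _ = H k @^-1` [set h | nth None h.1 l = None]).
      by apply: pre; exact: (@measurable_blank R n l).
    by apply/seteqP; split=> om /=; rewrite nth_rcons size_history_obs lk.
  + rewrite (_ : _ @^-1` _ = [set om | True]); first exact: measurable_const.
    apply/seteqP; split=> om //= _.
    by rewrite nth_rcons size_history_obs ltnNge ltnW// gtn_eqF.
  + rewrite (_ : _ @^-1` _ = [set om | (g k (H k om) && cred k om) = false]); first exact: ma.
    by apply/seteqP; split=> om /=; rewrite nth_rcons size_history_obs ltnn eqxx; case: ifP.
- have [lk|kl|->] := ltngtP l k.+1.
  + rewrite (_ : _ @^-1` _ = H k @^-1`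
        [set h | exists v : 'cV_n, nth None h.1 l = Some v /\ B (v i 0)]).
      by apply: pre; apply: sub_sigma_algebra; do 3 right; left; exists l, i, B.
    by apply/seteqP; split=> om /= [v]; rewrite ?nth_rcons ?size_history_obs ?lk => ?;
      exists v; rewrite ?nth_rcons ?size_history_obs ?lk.
  + rewrite (_ : _ @^-1` _ = [set om | False]); first exact: measurable_const.
    apply/seteqP; split=> om //= [v].
    by rewrite nth_rcons size_history_obs ltnNge ltnW// gtn_eqF//; case.
  + rewrite (_ : _ @^-1` _ = [set om | (g k (H k om) && cred k om) = true] `&`
       (fun om => state A m1 w k.+1 om i 0) @^-1` B).
      apply: measurableI; first exact: ma.
      by rewrite -[_ @^-1` _]setTI; exact: measurable_state.
    apply/seteqP; split=> om.
    * by move=> [v]; rewrite /= nth_rcons size_history_obs ltnn eqxx; case: ifP => _ [] // [<-].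
    * move=> [/= e Be]; exists (A *m state A m1 w k om + w k om).
      by rewrite nth_rcons size_history_obs ltnn eqxx e.
(* The action list is one shorter: the new action sits at position [k]. *)
- have [lk|kl|->] := ltngtP l k.
  + rewrite (_ : _ @^-1` _ = H k @^-1` [set h | nth false h.2 l]).
      by apply: pre; apply: sub_sigma_algebra; do 4 right; exists l.
    by apply/seteqP; split=> om /=; rewrite nth_rcons size_history_act lk.
  + rewrite (_ : _ @^-1` _ = [set om | False]); first exact: measurable_const.
    apply/seteqP; split=> om //=.
    by rewrite nth_rcons size_history_act ltnNge ltnW// gtn_eqF.
  + rewrite (_ : _ @^-1` _ = H k @^-1` [set h | g k h]); first by apply: pre; exact: mg.
    by apply/seteqP; split=> om /=; rewrite nth_rcons size_history_act ltnn eqxx.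
Qed.

Lemma measurable_estimate (h : estimator R n) k (i : 'I_n) : admissible_estimator h ->
  measurable_fun setT (fun om => h k (H k om) i 0).
Proof.
move=> ah; have /hist_measurable_funP mh := ah k i.
exact: (measurableT_comp mh (measurable_history k)).
Qed.

Lemma measurable_fun_if_action (f1 f0 : T -> R) k :
  measurable_fun setT f1 -> measurable_fun setT f0 ->
  measurable_fun setT (fun om => if g k (H k om) then f1 om else f0 om).
Proof.
by move=> ? ?; apply: measurable_fun_ifT => //; exact/measurable_fun_action/measurable_history.
Qed.

Lemma measurable_elapsed_history k j :
  measurable [set om | elapsed (H k om) = j].
Proof.
rewrite -[X in measurable X]setTI.
exact: (measurable_history k measurableT (@measurable_elapsed R n j)).
Qed.

End process_measurability.

(** * The accumulated noise is centred *)

Section noise_moments.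
Variables (R : realType) (n : nat) (d : measure_display) (T : measurableType d).
Variables (P : probability T R) (A : 'M[R]_n) (w : nat -> T -> 'cV[R]_n).
Hypothesis iw : forall t (i : 'I_n), P.-integrable setT (fun om => (w t om i 0)%:E).
Hypothesis w0 : forall t (i : 'I_n), (\int[P]_om (w t om i 0)%:E = 0)%E.

Lemma centered_state k (i : 'I_n) :
  P.-integrable setT (fun om => (state A (fun=> 0) w k om i 0)%:E) /\
  (\int[P]_om (state A (fun=> 0) w k om i 0)%:E = 0)%E.
Proof.
elim: k i => [|k ih] i /=.
  have e : (fun om : T => ((0 : 'cV[R]_n) i 0)%:E) = cst 0%E.
    by apply/funext => om; rewrite mxE.
  by rewrite e integral0; split=> //; exact: integrable0.
have e om : ((A *m state A (fun=> 0) w k om + w k om) i 0)%:E =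
    (\sum_j ((A i j)%:E * (state A (fun=> 0) w k om j 0)%:E) + (w k om i 0)%:E)%E.
  by rewrite mxE EFinD mxE -sumEFin.
have iA j : P.-integrable setT
    (fun om => ((A i j)%:E * (state A (fun=> 0) w k om j 0)%:E)%E).
  by apply: integrableZl => //; case: (ih j).
have iS : P.-integrable setT
    (fun om => (\sum_j ((A i j)%:E * (state A (fun=> 0) w k om j 0)%:E))%E).
  exact: integrable_sum.
under eq_fun do rewrite e.
split; first exact: integrableD.
rewrite integralD// w0 adde0 integral_sum// big1// => j _.
by rewrite integralZl//; case: (ih j) => // _ ->; rewrite mule0.
Qed.

End noise_moments.

(** * Independence of disjoint groups of sources *)

(** These finite intersections form a pi-system that generates the sigma-algebra of the sources in
    [S], and mutual independence is stated for precisely such sets. *)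
Definition source_cylinders {R : realType} {n : nat} {T : Type}
    (m1 : T -> 'cV[R]_n) (w : nat -> T -> 'cV[R]_n) (cred : nat -> T -> bool)
    (S : pred source) : set (set T) :=
  [set B | exists (I : seq source) (E : source -> set T),
    [/\ uniq I, {subset I <= S},
        forall s, s \in I -> source_events m1 w cred s (E s) &
        B = \bigcap_(s in [set` I]) E s]].

(** Every credibility variable counts as past, even those after [s]: they help to decide which later
    observations are blank, and they are independent of the noise. *)
Definition known_before (s : nat) : pred source :=
  fun x => if x is Some (inl t) then (t < s)%N else true.

Section sources.
Variables (R : realType) (n : nat) (d : measure_display) (Om : measurableType d).
Variables (P : probability Om R) (m1 : Om -> 'cV[R]_n) (w : nat -> Om -> 'cV[R]_n).
Variable cred : nat -> Om -> bool.
Local Notation events := (source_events m1 w cred).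
Local Notation cylinders := (source_cylinders m1 w cred).

Let vec_events_sigma (X : Om -> 'cV[R]_n) : sigma_algebra setT (vec_events X).
Proof. exact: smallest_sigma_algebra. Qed.

Lemma source_events_sigma x : sigma_algebra setT (events x).
Proof.
case: x => [[t|t]|] /=; try exact: vec_events_sigma.
split.
- by exists set0; rewrite preimage_set0.
- by move=> _ [B ->]; exists (~` B); rewrite setTD preimage_setC.
- move=> F FE; have [B BE] := choice FE.
  exists (\bigcup_k B k); rewrite preimage_bigcup.
  by apply: eq_bigcupr => k _; exact: BE.
Qed.

Lemma source_eventsI x : setI_closed (events x).
Proof.
move=> B C eB eC; rewrite -(sigma_algebra_id (source_events_sigma x)) in eB eC *.
exact: (@measurableI _ (g_sigma_algebraType (events x)) B C eB eC).
Qed.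

Lemma source_eventsT x : events x setT.
Proof.
have [e0 eC _] := source_events_sigma x.
by rewrite -(setD0 setT); exact: eC.
Qed.

Lemma source_cylindersI S : setI_closed (cylinders S).
Proof.
move=> _ _ [I [E [uI IS eE ->]]] [J [F [uJ JS eF ->]]].
(* A source absent from one of the lists contributes the full set there. *)
exists (undup (I ++ J)),
  (fun x => (if x \in I then E x else setT) `&` (if x \in J then F x else setT)).
split=> [||x xIJ|].
- exact: undup_uniq.
- by move=> x; rewrite mem_undup mem_cat => /orP[/IS|/JS].
- by apply: source_eventsI; case: ifPn => ?; auto using source_eventsT.
- apply/seteqP; split=> om /=.
  + by move=> [EI FJ] x /=; rewrite mem_undup mem_cat => _; split; case: ifP => // xI;
      [exact: EI|exact: FJ].
  + move=> EF; split=> x /= xI; have := EF x;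
      rewrite /= mem_undup mem_cat xI ?orbT => /(_ isT)[]//.
Qed.

Lemma source_cylinders1 (S : pred source) x B : S x -> events x B -> cylinders S B.
Proof.
move=> Sx eB; exists [:: x], (fun=> B); split=> //.
- by move=> y; rewrite inE => /eqP ->.
- by move=> y; rewrite inE => /eqP ->.
- apply/seteqP; split=> [om Bom y _//|om /(_ x)]; apply.
  by rewrite /= inE.
Qed.

Hypothesis mm1 : forall i : 'I_n, measurable_fun setT (fun om => m1 om i 0).
Hypothesis mw : forall t (i : 'I_n), measurable_fun setT (fun om => w t om i 0).
Hypothesis mcred : forall t, measurable [set om | cred t om].

Lemma measurable_source_events x : events x `<=` measurable.
Proof.
have mvec (X : Om -> 'cV[R]_n) : (forall i, measurable_fun setT (fun om => X om i 0)) ->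
    vec_events X `<=` measurable.
  move=> mX; apply: smallest_sub; first exact: sigma_algebra_measurable.
  move=> _ [i [B [mB ->]]]; rewrite -[X in measurable X]setTI.
  exact: (mX i measurableT B mB).
case: x => [[t|t]|] /=; [exact: mvec| |exact: mvec].
move=> _ [B ->]; rewrite -[_ @^-1` _]setTI.
have mc : measurable_fun setT (cred t).
  by apply: (measurable_fun_bool true); rewrite setTI; exact: mcred.
exact: mc.
Qed.

Lemma measurable_source_cylinders S : cylinders S `<=` measurable.
Proof.
move=> _ [I [E [uI IS eE ->]]].
apply: fin_bigcap_measurable => // x xI.
by apply: (@measurable_source_events x); exact: eE.
Qed.

Hypothesis ind : mutually_independent P m1 w cred.

(** For two cylinders over disjoint lists, the intersection is a cylinder over the concatenated
    list, and the product of probabilities splits accordingly. *)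
Lemma independent_sources S B C :
  <<s cylinders S >> B -> <<s cylinders (predC S) >> C ->
  (P (B `&` C) = P B * P C)%E.
Proof.
apply: independent_g_sigma_algebra; try exact: source_cylindersI;
  try exact: measurable_source_cylinders.
move=> _ _ [I [E [uI IS eE ->]]] [J [F [uJ JS eF ->]]].
have nIJ x : x \in J -> (x \in I) = false.
  by move=> /JS; apply: contraNF => /IS.
pose G x := if x \in I then E x else F x.
have GI : \bigcap_(x in [set` I]) E x = \bigcap_(x in [set` I]) G x.
  by apply: eq_bigcapr => x; rewrite /G /= => ->.
have GJ : \bigcap_(x in [set` J]) F x = \bigcap_(x in [set` J]) G x.
  by apply: eq_bigcapr => x; rewrite /G /= => /nIJ ->.
have eG x : x \in I ++ J -> events x (G x).
  rewrite mem_cat /G; case: ifP => [xI _|_ /= xJ]; [exact: eE|exact: eF].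
have -> : \bigcap_(x in [set` I]) E x `&` \bigcap_(x in [set` J]) F x =
    \bigcap_(x in [set` I ++ J]) G x.
  rewrite GI GJ -bigcap_setU; congr (\bigcap_(x in _) G x).
  by apply/seteqP; split=> x /=; rewrite mem_cat => /orP.
rewrite GI GJ !ind// ?big_cat// => [x xJ|x xI|].
- by apply: eG; rewrite mem_cat xJ orbT.
- by apply: eG; rewrite mem_cat xI.
- rewrite cat_uniq uI uJ andbT /=; apply/hasPn => x /nIJ /=.
  by move=> ->.
Qed.

Section generated.
Variable S : pred source.
Local Notation OmS := (g_sigma_algebraType (cylinders S)).

Lemma measurable_known_m1 (i : 'I_n) : S None ->
  measurable_fun setT (fun om : OmS => m1 om i 0).
Proof.
move=> SN _ B mB; rewrite setTI; apply: sub_sigma_algebra.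
apply: (@source_cylinders1 S None) => //; apply: sub_sigma_algebra.
by exists i, B.
Qed.

Lemma measurable_known_noise t (i : 'I_n) : S (Some (inl t)) ->
  measurable_fun setT (fun om : OmS => w t om i 0).
Proof.
move=> SN _ B mB; rewrite setTI; apply: sub_sigma_algebra.
apply: (@source_cylinders1 S (Some (inl t))) => //; apply: sub_sigma_algebra.
by exists i, B.
Qed.

Lemma measurable_known_cred t : S (Some (inr t)) ->
  measurable ([set om | cred t om] : set OmS).
Proof.
move=> SN; apply: sub_sigma_algebra.
by apply: (@source_cylinders1 S (Some (inr t))) => //; exists [set true].
Qed.

End generated.

End sources.

(** * Comparison of the costs *)

Section optimality.
Variables (R : realType) (n : nat) (d : measure_display) (Om : measurableType d).
Variables (P : probability Om R) (A : 'M[R]_n).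
Variables (m1 : Om -> 'cV[R]_n) (w : nat -> Om -> 'cV[R]_n).
Variables (cred : nat -> Om -> bool) (z : bool -> R) (ell : 'cV[R]_n -> bool -> R).
Variable g : strategy R n.
Hypothesis mm1 : forall i : 'I_n, measurable_fun setT (fun om => m1 om i 0).
Hypothesis mw : forall t (i : 'I_n), measurable_fun setT (fun om => w t om i 0).
Hypothesis mcred : forall t, measurable [set om | cred t om].
Hypothesis iw : forall t (i : 'I_n), P.-integrable setT (fun om => (w t om i 0)%:E).
Hypothesis w0 : forall t (i : 'I_n), (\int[P]_om (w t om i 0)%:E = 0)%E.
Hypothesis ind : mutually_independent P m1 w cred.
Hypothesis z0 : forall a, 0 <= z a.
Hypothesis ell0 : forall v a, 0 <= ell v a.
Hypothesis mell : forall a, vec_measurable_fun (fun v => ell v a).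
Hypothesis mg : admissible_strategy g.
Local Notation H := (history A m1 w cred g).
Local Notation X := (state A m1 w).

(** Fixing a coordinate makes the shift inequality scalar; fixing the elapsed time makes the
    splitting time [s] deterministic. *)
Definition error_component (h : estimator R n) (k j : nat) (i : 'I_n) (om : Om) : R :=
  (elapsed (H k om) == j)%:R *
  (z (g k (H k om)) * ((X k om - h k (H k om)) i 0) ^+ 2).

(** This is the form C (V + D)^2 of the shift inequality: the factor and the shift come from the
    past, and V is the noise accumulated since [s]. Off the event both sides vanish. *)
Lemma error_component_split h s j i om :
  let Hp := history A m1 (noise_before w s) cred g (s + j) om in
  error_component h (s + j) j i om =
  (elapsed Hp == j)%:R * z (g (s + j) Hp) *
  (state A (fun=> 0) (noise_from w s) (s + j) om i 0 +
   (state A m1 (noise_before w s) (s + j) om - h (s + j) Hp) i 0) ^+ 2.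
Proof.
move=> Hp; rewrite /error_component /Hp elapsed_blanks -mulrA.
have [e|_] := eqVneq; last by rewrite !mul0r.
rewrite -history_blanks ?e ?leqnn ?orbT// (state_split A m1 w s).
by rewrite !mxE addrAC addrA [in LHS](addrC _ (state _ _ _ _ _ _ _)) addrA.
Qed.

Lemma le_integral_error_component h k j i : (j <= k)%N -> admissible_estimator h ->
  (\int[P]_om (error_component (opt_estimator A) k j i om)%:E <=
   \int[P]_om (error_component h k j i om)%:E)%E.
Proof.
move=> jk ah; rewrite -(subnK jk); move: (k - j)%N => s {k jk}.
(* The variable [Y] will be the identity from [Om] to [OmS], the same set with the coarser
   sigma-algebra of the past. Depending on the past then means being measurable on [OmS]. *)
pose OmS := g_sigma_algebraType (source_cylinders m1 w cred (known_before s)).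
pose OmF := g_sigma_algebraType (source_cylinders m1 w cred (predC (known_before s))).
pose Hp := history A m1 (noise_before w s) cred g (s + j).
pose C (om : OmS) := (elapsed (Hp om) == j)%:R * z (g (s + j)%N (Hp om)).
pose D (om : OmS) := (state A m1 (noise_before w s) (s + j) om - h (s + j)%N (Hp om)) i 0.
pose V om := state A (fun=> 0) (noise_from w s) (s + j) om i 0.
have kn1 (l : 'I_n) : measurable_fun setT (fun om : OmS => m1 om l 0).
  exact: measurable_known_m1.
(* The truncated noise is known at all times: from [s] on it is constantly 0. *)
have knw t (l : 'I_n) : measurable_fun setT (fun om : OmS => noise_before w s t om l 0).
  rewrite /noise_before; have [ts|_] := ltnP t s; first exact: measurable_known_noise.
  exact: measurable_cst.
have knc t : measurable ([set om | cred t om] : set OmS) by exact: measurable_known_cred.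
have mHp := measurable_history A kn1 knw knc mg (s + j).
have mC : measurable_fun setT C.
  apply: measurable_funM.
    apply: (eq_measurable_fun (\1_[set om : OmS | elapsed (Hp om) = j] : OmS -> R)).
      by move=> om _; rewrite indicE; congr (nat_of_bool _)%:R; apply/idP/eqP;
        rewrite inE.
    by apply: measurable_indic; exact: measurable_elapsed_history.
  apply: (eq_measurable_fun
    (fun om : OmS => if g (s + j)%N (Hp om) then z true else z false)).
    by move=> om _; case: (g _ _).
  by apply: measurable_fun_if_action.
have mD : measurable_fun setT D.
  apply: (eq_measurable_fun (fun om : OmS => state A m1 (noise_before w s) (s + j) om i 0 -
      h (s + j)%N (Hp om) i 0)); first by move=> om _; rewrite /D !mxE.
  apply: measurable_funB; first exact: measurable_state.
  exact: measurable_estimate.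
have C0 om : 0 <= C om by rewrite mulr_ge0.
have [iV V0] : P.-integrable setT (EFin \o V) /\ (\int[P]_om (V om)%:E = 0)%E.
  apply: centered_state => t l; rewrite /noise_from; case: (ltnP t s) => // _.
  - by under eq_fun do rewrite mxE; exact: integrable0.
  - by under eq_integral do rewrite mxE; rewrite integral0.
have mF : measurable_fun setT (V : OmF -> R).
  apply: measurable_state => [l|t l].
    by under eq_fun do rewrite mxE; exact: measurable_cst.
  rewrite /noise_from; have [ts|ts] := ltnP t s.
    by under eq_fun do rewrite mxE; exact: measurable_cst.
  by apply: measurable_known_noise; rewrite /= -leqNgt.
have mid : measurable_fun setT (id : Om -> OmS).
  move=> _ B mB; rewrite setTI; move: B mB.
  apply: smallest_sub; first exact: sigma_algebra_measurable.
  by move=> B; exact: (measurable_source_cylinders mm1 mw mcred).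
have := le_integral_independent_shift (P := P) mid mC mD C0 iV V0.
rewrite (_ : (fun om => (C (id om) * V om ^+ 2)%:E) =
    (fun om => (error_component (opt_estimator A) (s + j) j i om)%:E)); last first.
  apply/funext => om; rewrite error_component_split /C -/(Hp om).
  have [e|_] := eqVneq; last by rewrite !mul0r.
  by rewrite opt_estimator_blanks// subrr mxE addr0.
rewrite (_ : (fun om => (C (id om) * (V om + D (id om)) ^+ 2)%:E) =
    (fun om => (error_component h (s + j) j i om)%:E)); last first.
  by apply/funext => om; rewrite error_component_split.
apply=> B E mB mE; apply: (independent_sources mm1 mw mcred ind (S := known_before s)) => //.
by rewrite -[_ @^-1` _]setTI; exact: mF.
Qed.

Local Notation sq h k om :=
  (((X k om - h k (H k om))^T *m (X k om - h k (H k om))) 0 0 * z (action A m1 w cred g k om)).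

(** For each coordinate only the term whose [j] is the actual elapsed time, which is at most [k],
    can be nonzero. *)
Lemma sqr_error_sum h k om :
  sq h k om = \sum_i \sum_(j < k.+1) error_component h k j i om.
Proof.
rewrite mxE mulr_suml; apply: eq_bigr => i _.
have jk : (elapsed (H k om) < k.+1)%N by rewrite ltnS elapsed_history.
rewrite (bigD1 (Ordinal jk))//= big1 ?addr0.
  by rewrite /error_component eqxx mul1r mxE expr2 mulrC.
by move=> j jn; rewrite /error_component -[_ == _]/(Ordinal jk == j) eq_sym (negbTE jn) mul0r.
Qed.

Lemma measurable_error_component h k j i : admissible_estimator h ->
  measurable_fun setT (error_component h k j i).
Proof.
move=> ah; apply: measurable_funM.
  apply: (eq_measurable_fun (\1_[set om | elapsed (H k om) = j] : Om -> R)).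
    by move=> om _; rewrite indicE; congr (nat_of_bool _)%:R; apply/idP/eqP;
      rewrite inE.
  by apply: measurable_indic; exact: measurable_elapsed_history.
apply: measurable_funM.
  apply: (eq_measurable_fun (fun om => if g k (H k om) then z true else z false)).
    by move=> om _; case: (g _ _).
  by apply: measurable_fun_if_action.
apply: measurable_funX.
apply: (eq_measurable_fun (fun om => X k om i 0 - h k (H k om) i 0)).
  by move=> om _; rewrite !mxE.
apply: measurable_funB; first exact: measurable_state.
exact: measurable_estimate.
Qed.

Lemma error_component_ge0 h k j i om : 0 <= error_component h k j i om.
Proof. by rewrite mulr_ge0// mulr_ge0// sqr_ge0. Qed.

Lemma integral_sqr_error h k : admissible_estimator h ->
  (\int[P]_om (sq h k om)%:E =
   \sum_i \sum_(j < k.+1) \int[P]_om (error_component h k j i om)%:E)%E.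
Proof.
move=> ah; have me j i : measurable_fun setT (fun om => (error_component h k j i om)%:E).
  by apply/measurable_EFinP; exact: measurable_error_component.
transitivity (\int[P]_om \sum_i \sum_(j < k.+1) (error_component h k j i om)%:E)%E.
  apply: eq_integral => om _; rewrite sqr_error_sum -sumEFin.
  by apply: eq_bigr => i _; rewrite sumEFin.
rewrite ge0_integral_sum//.
- apply: eq_bigr => i _; rewrite ge0_integral_sum// => j om _.
  by rewrite lee_fin error_component_ge0.
- by move=> i; apply: emeasurable_sum => j; exact: me.
- move=> i om _; by apply: sume_ge0 => j _; rewrite lee_fin error_component_ge0.
Qed.

Lemma measurable_sqr_error h k : admissible_estimator h ->
  measurable_fun setT (fun om => sq h k om).
Proof.
move=> ah; under eq_fun do rewrite sqr_error_sum.
by apply: measurable_sum => i; apply: measurable_sum => j; exact: measurable_error_component.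
Qed.

Lemma sqr_error_ge0 h k om : 0 <= sq h k om.
Proof.
by rewrite sqr_error_sum; do 2 (apply: sumr_ge0 => ? _); exact: error_component_ge0.
Qed.

Lemma measurable_state_cost k :
  measurable_fun setT (fun om => ell (X k om) (action A m1 w cred g k om)).
Proof.
have mX a : measurable_fun setT (fun om => ell (X k om) a).
  (* The sets with measurable preimage form a sigma-algebra, so the coordinate generators
     suffice. *)
  have mpre S : <<s @vec_gen R n >> S -> measurable (X k @^-1` S).
    move: S; apply: smallest_sub; last first.
      move=> _ [i [B [mB ->]]]; rewrite -[X in measurable X]setTI.
      exact: (measurable_state A mm1 mw k i measurableT).
    split=> /= [|S mS|F mF]; first by rewrite preimage_set0.
      by rewrite setTD preimage_setC; exact: measurableC.
    by rewrite preimage_bigcup; apply: bigcup_measurable => ? _; exact: mF.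
  by move=> _ B mB; rewrite setTI; exact: (mpre _ (@mell a B mB)).
apply: (eq_measurable_fun
  (fun om => if g k (H k om) then ell (X k om) true else ell (X k om) false)).
  by move=> om _; rewrite /action; case: (g _ _).
exact: measurable_fun_if_action.
Qed.

Lemma measurable_stage_cost h k : admissible_estimator h ->
  measurable_fun setT (stage_cost A m1 w cred z ell g h k).
Proof.
move=> ah; apply: measurable_funD; first exact: measurable_sqr_error.
exact: measurable_state_cost.
Qed.

Lemma stage_cost_ge0 h k om : 0 <= stage_cost A m1 w cred z ell g h k om.
Proof. by apply: addr_ge0 => //; exact: sqr_error_ge0. Qed.

(** States and actions are not influenced by the estimator, so the [ell] term is common to both
    sides. Its integral may be infinite; it is added, never cancelled. *)
Lemma le_integral_stage_cost h k : admissible_estimator h ->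
  (\int[P]_om (stage_cost A m1 w cred z ell g (opt_estimator A) k om)%:E <=
   \int[P]_om (stage_cost A m1 w cred z ell g h k om)%:E)%E.
Proof.
move=> ah.
have E h' : admissible_estimator h' ->
    (\int[P]_om (stage_cost A m1 w cred z ell g h' k om)%:E =
     \int[P]_om (sq h' k om)%:E +
     \int[P]_om (ell (X k om) (action A m1 w cred g k om))%:E)%E.
  move=> ah'; rewrite -ge0_integralD//.
  - by move=> om _; rewrite lee_fin; exact: sqr_error_ge0.
  - by apply/measurable_EFinP; exact: measurable_sqr_error.
  - by move=> om _; rewrite lee_fin.
  - by apply/measurable_EFinP; exact: measurable_state_cost.
rewrite !E//; last exact: opt_estimator_admissible.
apply: leeD => //; rewrite !integral_sqr_error//; last exact: opt_estimator_admissible.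
apply: lee_sum => i _; apply: lee_sum => j _; apply: le_integral_error_component => //.
by rewrite -ltnS.
Qed.

Lemma le_integral_discounted_cost h beta k : admissible_estimator h -> 0 <= beta ->
  (\int[P]_om (beta ^+ k * stage_cost A m1 w cred z ell g (opt_estimator A) k om)%:E <=
   \int[P]_om (beta ^+ k * stage_cost A m1 w cred z ell g h k om)%:E)%E.
Proof.
move=> ah b0.
have E h' : admissible_estimator h' ->
    (\int[P]_om (beta ^+ k * stage_cost A m1 w cred z ell g h' k om)%:E =
     (beta ^+ k)%:E * \int[P]_om (stage_cost A m1 w cred z ell g h' k om)%:E)%E.
  move=> ah'; under eq_integral do rewrite EFinM.
  rewrite ge0_integralZl//; last by rewrite lee_fin exprn_ge0.
    by apply/measurable_EFinP; exact: measurable_stage_cost.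
  by move=> om _; rewrite lee_fin; exact: stage_cost_ge0.
rewrite !E//; last exact: opt_estimator_admissible.
apply: lee_wpmul2l; first by rewrite lee_fin exprn_ge0.
exact: le_integral_stage_cost.
Qed.

Let measurable_discounted_cost h beta k : admissible_estimator h ->
  measurable_fun setT (fun om => (beta ^+ k * stage_cost A m1 w cred z ell g h k om)%:E).
Proof.
move=> ah; apply/measurable_EFinP; apply: measurable_funM => //.
exact: measurable_stage_cost.
Qed.

Let discounted_cost_ge0 h beta k om : 0 <= beta ->
  (0 <= (beta ^+ k * stage_cost A m1 w cred z ell g h k om)%:E)%E.
Proof. by move=> b0; rewrite lee_fin mulr_ge0 ?exprn_ge0 ?stage_cost_ge0. Qed.

(** An estimate enters only the cost of its own time step, so minimising every term separately
    minimises the sum. Nonnegativity allows the exchange of sum and integral even for infinite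
    costs. *)
Lemma le_finite_cost h beta N : admissible_estimator h -> 0 <= beta ->
  (finite_cost P A m1 w cred z ell g (opt_estimator A) beta N <=
   finite_cost P A m1 w cred z ell g h beta N)%E.
Proof.
move=> ah b0.
have E h' : admissible_estimator h' -> finite_cost P A m1 w cred z ell g h' beta N =
    (\sum_(k < N) \int[P]_om (beta ^+ k * stage_cost A m1 w cred z ell g h' k om)%:E)%E.
  move=> ah'; rewrite /finite_cost; under eq_integral do rewrite -sumEFin.
  by rewrite ge0_integral_sum// => k; [exact: measurable_discounted_cost|
    move=> om _; exact: discounted_cost_ge0].
rewrite !E//; last exact: opt_estimator_admissible.
by apply: lee_sum => k _; exact: le_integral_discounted_cost.
Qed.

Lemma le_infinite_cost h beta : admissible_estimator h -> 0 <= beta ->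
  (infinite_cost P A m1 w cred z ell g (opt_estimator A) beta <=
   infinite_cost P A m1 w cred z ell g h beta)%E.
Proof.
move=> ah b0.
have E h' : admissible_estimator h' -> infinite_cost P A m1 w cred z ell g h' beta =
    (\sum_(0 <= k <oo) \int[P]_om (beta ^+ k * stage_cost A m1 w cred z ell g h' k om)%:E)%E.
  move=> ah'; rewrite /infinite_cost integral_nneseries// => k.
    exact: measurable_discounted_cost.
  by move=> om _; exact: discounted_cost_ge0.
rewrite (E _ ah) (E _ (@opt_estimator_admissible _ _ A)).
apply: lee_nneseries => k *; last exact: le_integral_discounted_cost.
by apply: integral_ge0 => om _; exact: discounted_cost_ge0.
Qed.

End optimality.

Theorem theorem7 (R : realType) (n : nat) (d0 : measure_display)
    (Om : measurableType d0) (P : probability Om R)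
    (A : 'M[R]_n) (m1 : Om -> 'cV[R]_n) (w : nat -> Om -> 'cV[R]_n)
    (cred : nat -> Om -> bool) (q : R)
    (z : bool -> R) (ell : 'cV[R]_n -> bool -> R) (g : strategy R n) :
  (* measurability of the primitive random variables *)
  (forall i : 'I_n, measurable_fun setT (fun om => m1 om i 0)) ->
  (forall (t : nat) (i : 'I_n), measurable_fun setT (fun om => w t om i 0)) ->
  (forall t : nat, measurable [set om | cred t om]) ->
  (* zero-mean noise with finite covariance *)
  (forall (t : nat) (i : 'I_n), P.-integrable setT (fun om => (w t om i 0)%:E)) ->
  (forall (t : nat) (i : 'I_n), (\int[P]_om (w t om i 0)%:E = 0)%E) ->
  (forall (t : nat) (i : 'I_n), P.-integrable setT (fun om => (w t om i 0 ^+ 2)%:E)) ->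
  (* credibility probability q *)
  0 <= q <= 1 ->
  (forall t : nat, P [set om | cred t om] = q%:E) ->
  (* m_1, the noises and the credibility variables are mutually independent *)
  mutually_independent P m1 w cred ->
  (* cost data *)
  (forall a, 0 <= z a) ->
  (forall v a, 0 <= ell v a) ->
  (forall a, vec_measurable_fun (fun v => ell v a)) ->
  (* an arbitrary (measurable) sampling strategy *)
  admissible_strategy g ->
  (* \hat m_t = A^{y_t} x_t is an admissible estimator ... *)
  admissible_estimator (opt_estimator A) /\
  (* ... with \hat m_1 = m_1 ... *)
  (forall om, opt_estimator A 0 (history A m1 w cred g 0 om) = m1 om) /\
  (* ... satisfying the Kalman-like update ... *)
  (forall (k : nat) om,
     let mh := opt_estimator A k (history A m1 w cred g k om) in
     let hk1 := history A m1 w cred g k.+1 om in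
     opt_estimator A k.+1 hk1
       = A *m mh + gainL R n (elapsed hk1) *m (last_obs hk1 - A *m mh)) /\
  (* ... and optimal among all admissible estimators, for every discount factor,
     for every finite horizon and for the infinite horizon. *)
  (forall h : estimator R n, admissible_estimator h ->
   forall beta : R, 0 < beta <= 1 ->
     (forall Tn : nat,
        (finite_cost P A m1 w cred z ell g (opt_estimator A) beta Tn
         <= finite_cost P A m1 w cred z ell g h beta Tn)%E) /\
     (infinite_cost P A m1 w cred z ell g (opt_estimator A) beta
      <= infinite_cost P A m1 w cred z ell g h beta)%E).
Proof.
move=> mm1 mw mcred iw w0 _ _ _ ind z0 ell0 mell mg.
split; first exact: opt_estimator_admissible.
split; first by move=> om; rewrite /opt_estimator /= expr0 mul1mx.
split; first by move=> k om; exact: opt_estimator_kalman.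
move=> h ah beta /andP[/ltW b0 _].
split=> [N|]; first exact: le_finite_cost.
exact: le_infinite_cost.
Qed.
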